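(* Let $K$ be a field, let $r,s$ be non negative integers, and let $T_{r,s}$ be the double-star graph with edge ideal $I(T_{r,s})$ in $R=K[a,b,x_1,\dots,x_r,y_1,\dots,y_s]$. Then $$\mathrm{ara}\,I(T_{r,s})=\mathrm{pd}\,I(T_{r,s})=\mu(I(T_{r,s}))-\rho(I(T_{r,s}))+1=\max\{r,s\}+1.$$
   Context: The double-star graph $T_{r,s}$ is the tree on the $r+s+2$ distinct vertices $a,b,x_1,\dots,x_r,y_1,\dots,y_s$ with edges $\{a,b\}$, $\{a,x_i\}$ for $i=1,\dots,r$, and $\{b,y_i\}$ for $i=1,\dots,s$. Its edge ideal is the ideal of $R$ generated by the monomials $ab,\ ax_1,\dots,ax_r,\ by_1,\dots,by_s$. For an ideal $I$ of $R$, the arithmetical rank $\mathrm{ara}\,I$ is the least number of elements of $R$ which generate $I$ up to radical, and $\mathrm{pd}\,I$ denotes, by convention, the length of every minimal free resolution of the quotient $R/I$ over $R$. For the edge ideal $I=I(G)$ of a graph $G$ with at least one edge, $\mu(I)$ is the number of minimal monomial generators of $I$ (the number of edges of $G$), and $\rho(I)=\max_{\alpha}\min\{\deg(v): v\in\alpha\}$, where $\alpha$ ranges over the edges of $G$. *)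

(* Defs.v *)
From HB Require Import structures.
From mathcomp Require Import all_boot all_order all_algebra.
From mathcomp Require Import mpoly.

Set Implicit Arguments.
Unset Strict Implicit.
Unset Printing Implicit Defensive.

Import GRing.Theory.
Local Open Scope ring_scope.

Record sgraph (n : nat) := SGraph {
  adj :> rel 'I_n;
  adj_sym : ssrbool.symmetric adj;
  adj_irrefl : irreflexive adj }.

Definition degree n (G : sgraph n) (v : 'I_n) : nat := #|[set w | G v w]|.

(* Each edge is met twice, once for each orientation. *)
Definition rho n (G : sgraph n) : nat :=
  (\max_(p : 'I_n * 'I_n | G p.1 p.2) minn (degree G p.1) (degree G p.2))%N.

Section DoubleStar.
Variables r s : nat.

Definition va : 'I_(2 + (r + s)) := lshift (r + s) (0 : 'I_2).
Definition vb : 'I_(2 + (r + s)) := lshift (r + s) (1 : 'I_2).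
Definition vx (i : 'I_r) : 'I_(2 + (r + s)) := rshift 2 (lshift s i).
Definition vy (j : 'I_s) : 'I_(2 + (r + s)) := rshift 2 (rshift r j).

Definition ds_arc : rel 'I_(2 + (r + s)) := fun u v =>
  [|| (u == va) && (v == vb),
      (u == va) && [exists i, v == vx i]
    | (u == vb) && [exists j, v == vy j]].

Definition ds_adj : rel 'I_(2 + (r + s)) := fun u v => ds_arc u v || ds_arc v u.

Lemma ds_adj_sym : ssrbool.symmetric ds_adj.
Proof. by move=> u v; rewrite /ds_adj orbC. Qed.

Lemma ds_adj_irrefl : irreflexive ds_adj.
Proof.
move=> u; rewrite /ds_adj orbb; apply/negP; case/or3P=> /andP[/eqP-> ].
- by rewrite -val_eqE.
- by case/existsP=> i; rewrite -val_eqE.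
- by case/existsP=> i; rewrite -val_eqE.
Qed.

Definition double_star : sgraph (2 + (r + s)) := SGraph ds_adj_sym ds_adj_irrefl.

End DoubleStar.

Section Ideals.
Variables (K : fieldType) (n : nat).
Notation R := {mpoly K[n]}.

Definition gen_ideal (g : seq R) (p : R) : Prop :=
  exists c : 'I_(size g) -> R, p = \sum_(i < size g) c i * g`_i.

Definition same_ideal (I J : R -> Prop) : Prop := forall p, I p <-> J p.

Definition radical (I : R -> Prop) (p : R) : Prop := exists m : nat, I (p ^+ m).

Definition edge_ideal (G : sgraph n) : R -> Prop :=
  gen_ideal [seq 'X_p.1 * 'X_p.2 | p : 'I_n * 'I_n in [pred p | G p.1 p.2]].

Definition gen_up_to_radical (I : R -> Prop) (q : seq R) : Prop :=
  same_ideal (radical (gen_ideal q)) (radical I).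

Definition is_ara (I : R -> Prop) (k : nat) : Prop :=
  (exists2 q, size q = k & gen_up_to_radical I q) /\
  (forall q, gen_up_to_radical I q -> (k <= size q)%N).

Definition monomial_gens (I : R -> Prop) (S : seq 'X_{1..n}) : Prop :=
  same_ideal (gen_ideal [seq 'X_[m] | m <- S]) I.

Definition minimal_monomial_gens (I : R -> Prop) (S : seq 'X_{1..n}) : Prop :=
  [/\ uniq S, monomial_gens I S
    & forall T, {subset T <= S} -> monomial_gens I T -> {subset S <= T}].

Definition is_mu (I : R -> Prop) (k : nat) : Prop :=
  (exists S, minimal_monomial_gens I S) /\
  (forall S, minimal_monomial_gens I S -> size S = k).

(* A minimal graded free resolution
     ... --> R^(rk 2) --> R^(rk 1) --> R^(rk 0) --> R/I --> 0
   of R/I, for a homogeneous ideal I.  Maps act on row vectors from the right: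
   [diff i] is the map R^(rk i.+1) --> R^(rk i), and [aug] holds homogeneous
   representatives in R of the images in R/I of the basis of R^(rk 0).
   The [j]-th basis vector of R^(rk i) has degree [shift i j], and all the maps
   have degree 0.  Minimality: the entries of every [diff i] lie in the ideal
   generated by the variables. *)
Record min_free_resolution (I : R -> Prop) := MinFreeResolution {
  rk : nat -> nat;
  shift : forall i, 'I_(rk i) -> int;
  aug : 'cV[R]_(rk 0);
  diff : forall i, 'M[R]_(rk i.+1, rk i);
  aug_homog : forall j m, m \in msupp (aug j 0) -> (mdeg m)%:Z = shift j;
  diff_homog : forall i j k m, m \in msupp (diff i j k) ->
    (mdeg m)%:Z + shift k = shift j;
  aug_surj : forall p : R, exists v : 'rV_(rk 0), I (p - (v *m aug) 0 0);
  aug_exact : forall v : 'rV_(rk 0),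
    I ((v *m aug) 0 0) <-> exists w, v = w *m diff 0;
  diff_exact : forall i (v : 'rV_(rk i.+1)),
    v *m diff i = 0 <-> exists w, v = w *m diff i.+1;
  diff_minimal : forall i j k, (diff i j k)@_0%MM = 0 }.

Definition has_length (I : R -> Prop) (F : min_free_resolution I) (p : nat) :
    Prop :=
  (0 < rk F p)%N /\ forall i, (p < i)%N -> rk F i = 0%N.

Definition is_pd (I : R -> Prop) (p : nat) : Prop :=
  (exists F : min_free_resolution I, has_length F p) /\
  (forall F : min_free_resolution I, has_length F p).

End Ideals.

Arguments edge_ideal K {n} G _.

(* Main.v *)
Require Import Defs.
From mathcomp Require Import all_boot all_order all_algebra.
From mathcomp Require Import mpoly ring.

Set Implicit Arguments.
Unset Strict Implicit.
Unset Printing Implicit Defensive.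

Import GRing.Theory.
Local Open Scope ring_scope.

(** Write I for the edge ideal, generated by ab, a x_i and b y_j.

    The number mu. The edges give r + s + 1 monomials, none dividing another,
    and such a set of generators of a monomial ideal is contained in every set
    of monomial generators ([sub_minimal_monomial_gens]).  As the edge ab is
    the only one without a leaf, rho = min(r, s) + 1, so that
    mu - rho + 1 = max(r, s) + 1.

    Arithmetical rank, upper bound.  The max(r, s) + 1 elements ab and
    a x_k + b y_k, with missing variables read as 0, generate I up to radical:
    modulo ab, the square of a x_k is a x_k (a x_k + b y_k), and similarly for
    b y_k ([ds_radical_gensP]).

    Arithmetical rank, lower bound.  For every graph the arithmetical rank of
    the edge ideal is at least the degree of any vertex u ([degree_le_ara]):
    sending u to 1, the neighbours of u to independent variables and all other
    vertices to 0 maps the edge ideal onto the ideal of all variables.  That m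
    elements are needed to generate the ideal of m variables up to radical is
    proved by counting dimensions ([radical_maximal_ideal_size]): if q_1, ...,
    q_k have the radical (z_1, ..., z_m), then modulo polynomials of order t
    everything is a linear combination of products q^alpha z^e with the
    exponents alpha below t and the exponents e below a constant, and there are
    only O(t^k) of these, while the space has dimension of order t^m.

    Projective dimension, existence.  The ideals a (b, x_1, ..., x_r) and
    b (a, y_1, ..., y_s) have sum I and intersection (ab).  Hence a minimal
    resolution of R / I arises from the Koszul complexes P on b, x_1, ..., x_r
    and Q on a, y_1, ..., y_s: their direct sum in degrees at least 2, and in
    degree 1 the same direct sum with the basis vectors over b in P and over a
    in Q, both mapped to ab, identified ([acyclic_glue]).  In degree i >= 2 the
    rank is 'C(r + 1, i) + 'C(s + 1, i), so the length is max(r, s) + 1.  The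
    Koszul complexes are built as iterated mapping cones ([acyclic_cone]).

    Projective dimension, uniqueness.  Between two minimal resolutions of the
    same quotient the identity lifts to maps in both directions, the composites
    are homotopic to the identity, and at the origin all differentials vanish;
    so the composites are the identity there and the ranks agree ([leq_rk]). *)

(** * Ideals, radicals and monomial ideals *)

Section IdealTheory.
Variables (K : fieldType) (n : nat).
Implicit Types (p q : {mpoly K[n]}) (I J : {mpoly K[n]} -> Prop).
Implicit Types (g h : seq {mpoly K[n]}) (S : seq 'X_{1..n}).

Definition is_ideal J :=
  [/\ J 0, forall p q, J p -> J q -> J (p + q) & forall c p, J p -> J (c * p)].

Lemma ideal_sum J (A : Type) (s : seq A) (P : pred A) (F : A -> {mpoly K[n]}) :
  is_ideal J -> (forall i, P i -> J (F i)) -> J (\sum_(i <- s | P i) F i).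
Proof. by case=> J0 JD _ JF; elim/big_ind: _. Qed.

Lemma gen_ideal_is_ideal g : is_ideal (gen_ideal g).
Proof.
split.
- by exists (fun=> 0); rewrite big1 // => i _; rewrite mul0r.
- move=> p q [c ->] [d ->]; exists (fun i => c i + d i).
  by rewrite -big_split; apply: eq_bigr => i _; rewrite mulrDl.
- move=> e p [c ->]; exists (fun i => e * c i).
  by rewrite mulr_sumr; apply: eq_bigr => i _; rewrite mulrA.
Qed.

Lemma mem_gen_ideal g p : p \in g -> gen_ideal g p.
Proof.
move=> gp; have lt_pg : (index p g < size g)%N by rewrite index_mem.
exists (fun i => (i == Ordinal lt_pg)%:R).
rewrite (bigD1 (Ordinal lt_pg)) //= eqxx mul1r nth_index // big1 ?addr0 //.
by move=> i /negPf->; rewrite mul0r.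
Qed.

Lemma gen_ideal_least g J :
  is_ideal J -> {in g, forall p, J p} -> forall p, gen_ideal g p -> J p.
Proof.
move=> JI gJ p [c ->]; apply: ideal_sum => // i _.
by case: JI => _ _ JM; apply/JM/gJ/mem_nth.
Qed.

Lemma gen_ideal_sub g h :
  {in g, forall p, gen_ideal h p} -> forall p, gen_ideal g p -> gen_ideal h p.
Proof. by move=> gh p; apply: gen_ideal_least gh p; apply: gen_ideal_is_ideal. Qed.

Lemma edge_ideal_is_ideal (G : sgraph n) : is_ideal (edge_ideal K G).
Proof. exact: gen_ideal_is_ideal. Qed.

Lemma radical_sub I p : I p -> radical I p.
Proof. by exists 1%N. Qed.

(** In the binomial expansion of (p + q)^(k + l) every term contains p^k or
    q^l. *)
Lemma radical_is_ideal I : is_ideal I -> is_ideal (radical I).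
Proof.
move=> II; case: (II) => I0 ID IM; split.
- by exists 1%N.
- move=> p q [k Ik] [l Il]; exists (k + l)%N.
  rewrite exprDn; apply: ideal_sum => // i _; rewrite -mulr_natl; apply: (IM).
  have [le_il|lt_li] := leqP l i.
    by rewrite -(subnK le_il) exprD mulrA; apply: IM.
  have le_k : (k <= k + l - i)%N by rewrite -addnBA ?leq_addr // ltnW.
  by rewrite mulrC -(subnK le_k) exprD mulrA; apply: IM.
- by move=> c p [k Ik]; exists k; rewrite exprMn; apply: IM.
Qed.

Lemma gen_up_to_radicalP I g :
    is_ideal I -> {in g, forall p, I p} ->
    (forall p, I p -> radical (gen_ideal g) p) ->
  gen_up_to_radical I g.
Proof.
move=> II gI Ig p; split=> -[k].
  by move/(gen_ideal_least II gI)=> Ik; exists k.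
by case/Ig=> l; rewrite -exprM => gl; exists (k * l)%N.
Qed.

Definition monomial_ideal S := gen_ideal [seq 'X_[K, m] | m <- S].

(** Multiplication by a polynomial only produces multiples of the monomials
    already present, so the condition on the right defines an ideal. *)
Lemma monomial_idealP S p :
  monomial_ideal S p <-> {in msupp p, forall m, has (fun e => e <= m)%MM S}.
Proof.
split.
  apply: (@gen_ideal_least _ (fun p => {in msupp p, forall m,
    has (fun e => e <= m)%MM S})).
    split.
    - by move=> m; rewrite msupp0.
    - move=> p1 p2 h1 h2 m /msuppD_le; rewrite mem_cat.
      by case/orP=> [/h1|/h2].
    - move=> c q hq m /msuppM_le /allpairsP[[m1 m2] /= [_ /hq /hasP[e eS le_e] ->]].
      by apply/hasP; exists e => //; apply: lepm_trans le_e (lem_addl _ _).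
  move=> _ /mapP[e eS ->] m; rewrite msuppX inE => /eqP->.
  by apply/hasP; exists e; rewrite ?lepm_refl.
move=> h; rewrite (mpolyE p) big_seq; apply: ideal_sum.
  exact: gen_ideal_is_ideal.
move=> m /h /hasP[e eS /submK <-]; rewrite mpolyXD -mul_mpolyC mulrA.
have [_ _] := gen_ideal_is_ideal [seq 'X_[K, m] | m <- S]; apply.
by apply: mem_gen_ideal; apply: map_f.
Qed.

(** A monomial not involving the [i]-th variable divides X_i m only if it
    divides m.  This one fact yields both the regularity of sequences of
    variables and the coprimality of two distinct variables. *)
Lemma monomial_ideal_var_regular S (i : 'I_n) p :
    {in S, forall e : 'X_{1..n}, e i = 0%N} ->
  monomial_ideal S ('X_i * p) -> monomial_ideal S p.
Proof.
move=> Si0 /monomial_idealP h; apply/monomial_idealP => m pm.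
have /h/hasP[e eS le_e] : (U_(i) + m)%MM \in msupp ('X_i * p).
  by rewrite mcoeff_msupp mulrC mcoeffMX -mcoeff_msupp.
apply/hasP; exists e => //; apply/mnm_lepP => j.
move/mnm_lepP: le_e => /(_ j); rewrite mnmDE mnm1E.
by case: eqP => [<-|_]; rewrite ?add0n // Si0.
Qed.

Lemma monomial_ideal1P e p :
  monomial_ideal [:: e] p <-> exists q, p = 'X_[e] * q.
Proof.
split; first by case=> c; rewrite big_ord1 /= => ->; exists (c ord0); rewrite mulrC.
case=> q ->; rewrite mulrC; have [_ _] := gen_ideal_is_ideal [:: 'X_[K, e]]; apply.
by apply: mem_gen_ideal; rewrite inE.
Qed.

(** A monomial e of the antichain [E] is divisible by some f in [S], which is
    divisible by some e' in [E]; then e' = e, and so f = e. *)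
Lemma sub_minimal_monomial_gens I E S :
    {in E &, forall e f, (e <= f)%MM -> e = f} ->
    monomial_gens (K := K) I E -> monomial_gens (K := K) I S ->
  {subset E <= S}.
Proof.
move=> antiE IE IS e eE.
have IX T f : monomial_gens I T -> f \in T -> I 'X_[K, f].
  by move=> IT fT; apply/IT/mem_gen_ideal/map_f.
have in_gens T f : monomial_gens I T -> I 'X_[K, f] -> has (fun e => e <= f)%MM T.
  by move=> IT /IT /monomial_idealP; apply; rewrite msuppX inE.
have /hasP[f fS le_fe] := in_gens S e IS (IX E e IE eE).
have /hasP[e' e'E le_e'f] := in_gens E f IE (IX S f IS fS).
have e'e : e' = e by apply: antiE => //; apply: lepm_trans le_fe.
suff <- : f = e by [].
apply/mnmP=> i; apply/eqP; rewrite eqn_leq.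
by move: le_fe le_e'f; rewrite e'e => /mnm_lepP-> /mnm_lepP->.
Qed.

Lemma antichain_is_mu I E :
    uniq E -> {in E &, forall e f, (e <= f)%MM -> e = f} ->
    monomial_gens (K := K) I E ->
  is_mu I (size E).
Proof.
move=> uE antiE IE; split.
  by exists E; split=> // T _; apply: sub_minimal_monomial_gens.
move=> S [uS IS minS]; apply/eqP; rewrite -uniq_size_uniq //.
have sES := sub_minimal_monomial_gens antiE IE IS.
by move=> e; apply/idP/idP; [apply: sES | apply: minS].
Qed.

End IdealTheory.

Lemma ideal_preim (K : fieldType) (m n : nat)
    (f : {rmorphism {mpoly K[m]} -> {mpoly K[n]}}) (J : {mpoly K[n]} -> Prop) :
  is_ideal J -> is_ideal (fun p => J (f p)).
Proof.
case=> J0 JD JM; split; first by rewrite rmorph0.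
- by move=> p q Jp Jq; rewrite rmorphD; apply: JD.
- by move=> c p Jp; rewrite rmorphM; apply: JM.
Qed.

(** * A lower bound for the number of generators up to radical *)

Section DimensionCount.
Variables (K : fieldType) (n : nat) (q : seq {mpoly K[n]}).
Implicit Types (f : {mpoly K[n]}) (V : {mpoly K[n]} -> Prop).

Definition is_subspace V :=
  [/\ V 0, forall f1 f2, V f1 -> V f2 -> V (f1 + f2) & forall a f, V f -> V (a *: f)].

(** For t varying, these are the powers of the ideal of all variables. *)
Definition order_ge t f := {in msupp f, forall m, (t <= mdeg m)%N}.

Definition box_monomial N : 'X_{1..n} -> Prop := fun e => forall i, (e i < N)%N.

Definition qpower (a : 'I_(size q) -> nat) := \prod_(j < size q) q`_j ^+ a j.

(** The linear span of the products q^alpha X^e together with the polynomials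
    of order at least [t] is the whole ring.  It is described as the least
    subspace containing them: then, to see that g q_j lies in it, induction on
    [t] is applied to g and the subspace of all g with g q_j in [V].  A monomial
    outside the box of exponents below [N] is a multiple of some X_i^N, hence a
    combination of the q_j, and each factor q_j raises the order by at least 1
    because it vanishes at the origin. *)
Lemma span_qpower_boxes N t V :
    (forall i, gen_ideal q ('X_i ^+ N)) -> {in q, forall p, p@_0%MM = 0} ->
    is_subspace V ->
    (forall a e, (forall j, (a j < t)%N) -> box_monomial N e ->
      V (qpower a * 'X_[e])) ->
    (forall f, order_ge t f -> V f) ->
  forall f, V f.
Proof.
move=> qX q0; elim: t V => [|t IH] V Vsub Vgen Vord f; first exact: Vord.
have [V0 VD VZ] := Vsub.
have Vmul g j : V (g * q`_j).
  apply: (IH (fun g => V (g * q`_j))) => {g}.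
  - split; first by rewrite mul0r.
    + by move=> g1 g2 V1 V2; rewrite mulrDl; apply: VD.
    + by move=> a g Vg; rewrite -scalerAl; apply: VZ.
  - move=> a e lt_at e_box.
    rewrite -mulrA ['X_[e] * _]mulrC mulrA.
    have [lt_j|le_j] := ltnP j (size q); last first.
      by rewrite nth_default // mulr0 mul0r.
    pose a' i := (a i + (i == Ordinal lt_j))%N.
    suff -> : qpower a * q`_j = qpower a'.
      apply: Vgen => // i; rewrite ltnS; apply: leq_trans (lt_at i).
      by rewrite -addn1 leq_add2l leq_b1.
    rewrite /qpower (bigD1 (Ordinal lt_j)) // [RHS](bigD1 (Ordinal lt_j)) //=.
    rewrite /a' eqxx addn1 exprSr mulrAC; congr (_ * _).
    by apply: eq_bigr => i /negPf->; rewrite addn0.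
  - move=> g g_ord; have [lt_j|le_j] := ltnP j (size q); last first.
      by rewrite nth_default // mulr0.
    apply: Vord => _ /msuppM_le /allpairsP[[m1 m2] /= [/g_ord m1t m2q ->]].
    rewrite mdegD -addn1 leq_add // lt0n mdeg_eq0.
    apply: contraTneq m2q => ->; rewrite mcoeff_msupp negbK.
    by apply/eqP/q0/mem_nth.
rewrite (mpolyE f); elim/big_ind: _ => // m _; apply: VZ.
case: (boolP [forall i, m i < N]%N) => [/forallP m_box|].
  have := Vgen (fun=> 0%N) m (fun=> isT) m_box.
  by rewrite /qpower big1 ?mul1r // => j _; rewrite expr0.
rewrite negb_forall => /existsP[i]; rewrite -leqNgt => le_N.
have le_m : (U_(i) *+ N <= m)%MM.
  by apply/mnm_lepP=> j; rewrite mulmnE mnm1E; case: eqP => [<-|]; rewrite ?mul1n.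
rewrite -(submK le_m) mpolyXD -mpolyXn; have [c ->] := qX i.
rewrite mulr_sumr; elim/big_ind: _ => // j _; rewrite mulrA.
exact: Vmul.
Qed.

(** The coefficients at the monomials with all exponents below [u] are arbitrary,
    while such monomials have degree below t = n u; so the truncations to these
    coefficients of the spanning products for that t have rank u^n. *)
Lemma box_count N u :
    (0 < n)%N ->
    (forall i, gen_ideal q ('X_i ^+ N)) -> {in q, forall p, p@_0%MM = 0} ->
  (u ^ n <= (n * u) ^ size q * N ^ n)%N.
Proof.
move=> n_gt0 qX q0; pose t := (n * u)%N.
pose mon M (e : {ffun 'I_n -> 'I_M}) := [multinom e i : nat | i < n].
pose T f := \row_(i < #|{ffun 'I_n -> 'I_u}|) f@_(mon u (enum_val i)).
pose gens := ({ffun 'I_(size q) -> 'I_t} * {ffun 'I_n -> 'I_N})%type.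
pose gen (x : gens) := qpower (fun j => x.1 j) * 'X_[mon N x.2].
pose A := \matrix_(i < #|{: gens}|) T (gen (enum_val i)).
have TA f : (T f <= A)%MS.
  apply: (@span_qpower_boxes N t (fun f => (T f <= A)%MS)) => // {f}.
  - split.
    + by rewrite (_ : T 0 = 0) ?sub0mx //; apply/rowP=> i; rewrite !mxE mcoeff0.
    + move=> f1 f2 A1 A2; rewrite (_ : T _ = T f1 + T f2) ?addmx_sub //.
      by apply/rowP=> i; rewrite !mxE mcoeffD.
    + move=> a f Af; rewrite (_ : T _ = a *: T f) ?scalemx_sub //.
      by apply/rowP=> i; rewrite !mxE mcoeffZ.
  - move=> a e a_lt e_lt.
    pose x : gens := ([ffun j => Ordinal (a_lt j)], [ffun i => Ordinal (e_lt i)]).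
    suff -> : qpower a * 'X_[e] = gen x.
      rewrite (_ : T _ = row (enum_rank x) A) ?row_sub //.
      by apply/rowP=> i; rewrite !mxE enum_rankK.
    congr (_ * 'X_[_]); first by apply: eq_bigr => j _; rewrite ffunE.
    by apply/mnmP=> i; rewrite mnmE ffunE.
  - move=> f f_ord; rewrite (_ : T f = 0) ?sub0mx //.
    apply/rowP=> i; rewrite !mxE; apply: memN_msupp_eq0.
    apply/negP=> /f_ord; apply/negP; rewrite -ltnNge mdegE /t.
    rewrite -[X in (_ < X * u)%N]card_ord -sum_nat_const.
    set e := enum_val i; rewrite [X in (X < _)%N](eq_bigr (fun j => e j : nat)).
      rewrite (bigD1 (Ordinal n_gt0)) // [X in (_ < X)%N](bigD1 (Ordinal n_gt0)) //=.
      rewrite -addSn leq_add //.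
      by apply: leq_sum => j _; apply/ltnW/ltn_ord.
    by move=> j _; rewrite mnmE.
have : (1%:M <= A)%MS.
  apply/row_subP=> i; rewrite (_ : row i _ = T 'X_[mon u (enum_val i)]) //.
  apply/rowP=> j; rewrite !mxE mcoeffX; congr (nat_of_bool _)%:R.
  apply/idP/eqP=> [/eqP->//|/mnmP eq_ij]; apply/eqP/enum_val_inj/ffunP => k.
  by apply: val_inj; have := eq_ij k; rewrite !mnmE.
move/mxrankS; rewrite mxrank1 => /leq_trans /(_ (rank_leq_row _)).
by rewrite card_prod !card_ffun !card_ord.
Qed.

(** The height theorem for the ideal of all variables.  If [q] had fewer than
    [n] elements, the inequality of [box_count], for [N] fixed, would bound the
    power u^n by a constant multiple of a lower power of u. *)
Lemma radical_maximal_ideal_size :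
    (forall i, radical (gen_ideal q) 'X_i) -> {in q, forall p, p@_0%MM = 0} ->
  (n <= size q)%N.
Proof.
move=> radX q0; case: (leqP n 0) => [|n_gt0].
  by rewrite leqn0 => /eqP n0; apply: (@leq_trans 0); rewrite ?n0.
have [N0 N0X] := fin_all_exists radX.
pose N := (\max_i N0 i)%N.
have qX i : gen_ideal q ('X_i ^+ N).
  have le_N : (N0 i <= N)%N by apply: leq_bigmax.
  rewrite -(subnK le_N) exprD; have [_ _] := gen_ideal_is_ideal q; exact.
(* The least u exceeding the constant factor of box_count. *)
pose u := (n ^ size q * N ^ n).+1.
rewrite leqNgt; apply/negP=> lt_qn.
have := box_count u n_gt0 qX q0; apply/negP; rewrite -ltnNge.
rewrite expnMn mulnAC; apply: (@leq_trans (u ^ (size q).+1)).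
  by rewrite expnS ltn_pmul2r // expn_gt0.
by rewrite leq_pexp2l.
Qed.

End DimensionCount.

(** * Ranks of minimal free resolutions *)

Section Comparison.
Variables (K : fieldType) (n : nat) (I : {mpoly K[n]} -> Prop).
Hypothesis I_ideal : is_ideal I.
Implicit Types F G : min_free_resolution I.

(** The map from degree 0 takes values in R / I and the matrix [aug] represents it
    modulo [I] only, so commutation with it is a congruence of matrices. *)
Definition mx_in (m p : nat) (M : 'M[{mpoly K[n]}]_(m, p)) :=
  forall i j, I (M i j).

Lemma mx_in_add m p (M N : 'M_(m, p)) : mx_in M -> mx_in N -> mx_in (M + N).
Proof. by move=> IM IN i j; rewrite mxE; case: I_ideal => _ ID _; apply: ID. Qed.

Lemma mx_in_mul m p k (A : 'M_(m, p)) (M : 'M_(p, k)) :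
  mx_in M -> mx_in (A *m M).
Proof.
move=> IM i j; rewrite mxE; apply: ideal_sum => // l _.
by case: I_ideal => _ _; apply.
Qed.

Lemma lift_rows (A : comNzRingType) m p k (D : 'M[A]_(k, p)) (M : 'M[A]_(m, p)) :
  (forall i, exists w, row i M = w *m D) -> exists W, M = W *m D.
Proof.
case/fin_all_exists=> w Mw; exists (\matrix_i w i).
by apply/row_matrixP=> i; rewrite row_mul rowK -Mw.
Qed.

Lemma lift_diff F i m (M : 'M_(m, rk F i.+1)) :
  M *m diff F i = 0 -> exists W, M = W *m diff F i.+1.
Proof.
by move=> M0; apply: lift_rows => j; apply/diff_exact; rewrite -row_mul M0 row0.
Qed.

Lemma lift_aug F m (M : 'M_(m, rk F 0)) :
  mx_in (M *m aug F) -> exists W, M = W *m diff F 0.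
Proof.
move=> IM; apply: lift_rows => j; apply/aug_exact.
by rewrite -row_mul mxE; apply: IM.
Qed.

Lemma mul_diff F i : diff F i.+1 *m diff F i = 0.
Proof.
apply/row_matrixP=> j; rewrite row_mul row0; apply/diff_exact.
by exists (delta_mx 0 j); rewrite -rowE.
Qed.

Lemma mul_diff_aug F : mx_in (diff F 0 *m aug F).
Proof.
move=> j k; rewrite [k]ord1.
have : I ((row j (diff F 0) *m aug F) 0 0).
  by apply/aug_exact; exists (delta_mx 0 j); rewrite -rowE.
by rewrite -row_mul mxE.
Qed.

Lemma augmentation_lift F G :
  exists f : 'M_(rk F 0, rk G 0), mx_in (f *m aug G - aug F).
Proof.
have /fin_all_exists[v Iv] (j : 'I_(rk F 0)) := aug_surj G (aug F j 0).
exists (\matrix_j v j) => j k; rewrite [k]ord1 mxE.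
have -> : (\matrix_j v j *m aug G) j 0 = (v j *m aug G) 0 0.
  by rewrite -[in RHS](rowK v) -row_mul [RHS]mxE.
have [_ _ IM] := I_ideal.
by rewrite [X in _ + X]mxE -opprB -mulN1r; apply/IM/Iv.
Qed.

Definition const_mx0 m p (M : 'M[{mpoly K[n]}]_(m, p)) := map_mx (mcoeff 0%MM) M.

Lemma const_diff F i : const_mx0 (diff F i) = 0.
Proof. by apply/matrixP=> j k; rewrite !mxE diff_minimal. Qed.

(** The induction hypothesis for building a chain map f : F -> G, a chain map
    g : G -> F and a homotopy h from their composite to the identity, degree by
    degree.  The lifts [f'] and [g'] are the components of f and g in the next
    degree.  The homotopy relation in degree [i] also has a term passing through
    degree [i] - 1; multiplying by [diff F i] removes that term.  The last clause
    is the consequence of minimality that survives: at the origin, f g = 1. *)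
Definition homotopy_retract_at F G i :=
  exists (f : 'M_(rk F i, rk G i)) (g : 'M_(rk G i, rk F i))
         (h : 'M_(rk F i, rk F i.+1)) f' g',
  [/\ diff F i *m f = f' *m diff G i,
      diff G i *m g = g' *m diff F i,
      diff F i *m (f *m g - 1%:M) = diff F i *m h *m diff F i
    & const_mx0 f *m const_mx0 g = 1%:M].

Lemma homotopy_retract F G i : homotopy_retract_at F G i.
Proof.
elim: i => [|i [f [g [h [f' [g' [Df Dg Dh _]]]]]]].
  have [f If] := augmentation_lift F G; have [g Ig] := augmentation_lift G F.
  have [h Dh] : exists h, f *m g - 1%:M = h *m diff F 0.
    apply: lift_aug; rewrite mulmxBl mul1mx -mulmxA.
    rewrite -(subrK (f *m aug G) (f *m (g *m aug F))) -mulmxBr -addrA.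
    by apply: mx_in_add => //; apply: mx_in_mul.
  have [f' Df] : exists f', diff F 0 *m f = f' *m diff G 0.
    apply: lift_aug; rewrite -mulmxA -(subrK (aug F) (f *m aug G)) mulmxDr.
    by apply: mx_in_add; [apply: mx_in_mul | apply: mul_diff_aug].
  have [g' Dg] : exists g', diff G 0 *m g = g' *m diff F 0.
    apply: lift_aug; rewrite -mulmxA -(subrK (aug G) (g *m aug F)) mulmxDr.
    by apply: mx_in_add; [apply: mx_in_mul | apply: mul_diff_aug].
  exists f, g, h, f', g'; split=> //; first by rewrite Dh mulmxA.
  rewrite /const_mx0 -map_mxM -(subrK 1%:M (f *m g)) Dh map_mxD map_mxM map_mx1.
  by rewrite [map_mx _ (diff F 0)]const_diff mulmx0 add0r.
(* With the composite corrected by the previous homotopy the image is made of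
   cycles, so it lifts to the next homotopy. *)
have [h' Dh'] : exists h', f' *m g' - 1%:M - diff F i *m h = h' *m diff F i.+1.
  apply: lift_diff; rewrite !mulmxBl mul1mx -mulmxA -Dg mulmxA -Df -mulmxA.
  by rewrite -Dh mulmxBr mulmx1 subrr.
have [f'' Df'] : exists f'', diff F i.+1 *m f' = f'' *m diff G i.+1.
  by apply: lift_diff; rewrite -mulmxA -Df mulmxA mul_diff mul0mx.
have [g'' Dg'] : exists g'', diff G i.+1 *m g' = g'' *m diff F i.+1.
  by apply: lift_diff; rewrite -mulmxA -Dg mulmxA mul_diff mul0mx.
exists f', g', h', f'', g''; split=> //.
  rewrite -(subrK (diff F i *m h) (_ - _)) Dh' mulmxDr [_ *m (_ *m h)]mulmxA.
  by rewrite mul_diff mul0mx addr0 mulmxA.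
rewrite /const_mx0 -map_mxM -(subrK 1%:M (f' *m g')).
rewrite -(subrK (diff F i *m h) (_ - _)) Dh' !(map_mxD, map_mxM) map_mx1.
rewrite [map_mx _ (diff F i)]const_diff [map_mx _ (diff F i.+1)]const_diff.
by rewrite mulmx0 mul0mx !add0r.
Qed.

(** The constant terms of f and g are matrices over the field K with f g = 1, so
    the middle rank is at least the outer one. *)
Lemma leq_rk F G i : (rk F i <= rk G i)%N.
Proof.
by have [f [g [_ [_ [_ [_ _ _ fg1]]]]]] := homotopy_retract F G i;
   apply: mulmx1_min fg1.
Qed.

Lemma pd_of_resolution F p : has_length F p -> is_pd I p.
Proof.
move=> Fp; split; first by exists F.
move=> G; have rkE i : rk G i = rk F i by apply/eqP; rewrite eqn_leq !leq_rk.
by case: Fp => rkp rk0; split; rewrite ?rkE // => i /rk0; rewrite rkE.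
Qed.

End Comparison.

(** * Mapping cones and glued complexes *)

Section Complexes.
Variable A : idomainType.
Implicit Types (a b x y z : A).

Definition rank_from0 (p : nat -> nat) i := if i is j.+1 then p j else 1%N.

(** A complex of finite free modules whose module of degree 0 is A itself:
    [prk i] is the rank in degree i + 1, and [pdiff i] is the map from degree
    i + 1 to degree i.  Fixing the rank 1 in degree 0 definitionally makes the
    block matrices below well typed without casts. *)
Record rank1_complex := Rank1Complex {
  prk : nat -> nat;
  pdiff : forall i, 'M[A]_(prk i, rank_from0 prk i) }.
Implicit Types C D : rank1_complex.

Definition acyclic C := forall i (v : 'rV_(prk C i)),
  v *m pdiff C i = 0 <-> exists w, v = w *m pdiff C i.+1.

Definition complex_ideal C x := exists v, x%:M = v *m pdiff C 0.

Lemma scale_mx_eq0 a m p (M : 'M[A]_(m, p)) : a != 0 -> a *: M = 0 -> M = 0.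
Proof.
move=> a0 /matrixP aM0; apply/matrixP=> i j; rewrite mxE; apply: (mulfI a0).
by have := aM0 i j; rewrite !mxE mulr0.
Qed.

Lemma acyclic_mul0 C i : acyclic C -> pdiff C i.+1 *m pdiff C i = 0.
Proof.
move=> Ce; apply/row_matrixP=> j; rewrite row_mul row0; apply/Ce.
by exists (delta_mx 0 j); rewrite -rowE.
Qed.

Definition trivial_complex : rank1_complex := @Rank1Complex (fun=> 0%N) (fun i => 0).

Lemma acyclic_trivial : acyclic trivial_complex.
Proof.
move=> i v; split=> _; last by rewrite [v]thinmx0 mul0mx.
by exists 0; rewrite [v]thinmx0 mul0mx.
Qed.

Definition cone_rank C i := (prk C i + rank_from0 (prk C) i)%N.

(** The mapping cone of multiplication by [z] on [C]: in degree i + 1 its module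
    is the sum of the modules of [C] in degrees i + 1 and i, and (u, w) is sent
    to (d u + z w, - d w), or to d u + z w alone if i = 0. *)
Definition cone_diff z C i : 'M[A]_(cone_rank C i, rank_from0 (cone_rank C) i) :=
  match i return 'M[A]_(cone_rank C i, rank_from0 (cone_rank C) i) with
  | 0 => col_mx (pdiff C 0) z%:M
  | j.+1 => block_mx (pdiff C j.+1) 0 z%:M (- pdiff C j)
  end.

Definition cone z C := Rank1Complex (cone_diff z C).

(** If w = d w' and d u + z w = 0, then u + z w' is a cycle, hence u + z w' = d u2,
    and (u, w) is the image of (u2, - w'). *)
Lemma cone_lift z C i (u : 'rV_(prk C i)) (w' : 'rV_(prk C i)) :
    acyclic C -> u *m pdiff C i + z *: (w' *m pdiff C i) = 0 ->
  exists t : 'rV_(prk (cone z C) i.+1),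
    row_mx u (w' *m pdiff C i) = t *m pdiff (cone z C) i.+1.
Proof.
move=> Ce; rewrite scalemxAl -mulmxDl => /Ce[u2 u2E].
exists (row_mx u2 (- w')); rewrite /= mul_row_block mulmx0 add0r !mulNmx mulmxN opprK.
by rewrite -u2E mul_mx_scalar addrK.
Qed.

(** For a cycle (u, w) of the cone, w is a boundary, and [cone_lift] applies: in
    positive degree w is itself a cycle of [C]; in degree 0 regularity is used,
    since z w = - d u lies in the ideal of [C]. *)
Lemma acyclic_cone z C :
    acyclic C -> (forall x, complex_ideal C (z * x) -> complex_ideal C x) ->
  acyclic (cone z C).
Proof.
move=> Ce zreg i v; split; last first.
  case=> w ->; rewrite -mulmxA.
  suff -> : pdiff (cone z C) i.+1 *m pdiff (cone z C) i = 0 by rewrite mulmx0.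
  case: i {v w} => [|i] /=.
    rewrite mul_block_col mul0mx addr0 acyclic_mul0 // mul_scalar_mx.
    by rewrite mul_mx_scalar scalerN subrr col_mx0.
  rewrite mulmx_block !mul0mx !mulmx0 !addr0 !acyclic_mul0 // mul_scalar_mx.
  rewrite mul_mx_scalar scalerN subrr mulmxN mulNmx opprK acyclic_mul0 //.
  by rewrite add0r block_mx0.
move=> v0; rewrite -(hsubmxK v) in v0 *; move: (lsubmx v) (rsubmx v) v0 => u w {v}.
case: i u w => [|i] u w /=.
  rewrite mul_row_col mul_mx_scalar => uw0.
  have [w' w'E] : complex_ideal C (w 0 0).
    apply: zreg; exists (- u); rewrite mulNmx; apply/eqP; rewrite -addr_eq0 addrC.
    by rewrite scalar_mxM -mx11_scalar mul_scalar_mx uw0.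
  rewrite -mx11_scalar in w'E; rewrite w'E.
  by apply: cone_lift; rewrite -?w'E.
rewrite mul_row_block mulmx0 add0r mulmxN mul_mx_scalar -row_mx0 => /eq_row_mx[uw0].
move/eqP; rewrite oppr_eq0 => /eqP/Ce[w' w'E]; rewrite w'E.
by apply: cone_lift; rewrite -?w'E.
Qed.

Lemma complex_ideal_cone z C x :
  complex_ideal (cone z C) x <-> exists y t, complex_ideal C y /\ x = y + z * t.
Proof.
split=> [[v] | [y [t [[u uE] ->]]]].
  rewrite -(hsubmxK v) /= mul_row_col mul_mx_scalar => xE.
  exists ((lsubmx v *m pdiff C 0) 0 0), ((rsubmx v) 0 0); split.
    by exists (lsubmx v); rewrite -mx11_scalar.
  by have /matrixP/(_ 0 0) := xE; rewrite [X in X = _]mxE !mxE eqxx mulr1n.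
exists (row_mx u t%:M); rewrite /= mul_row_col -uE raddfD /=; congr (_ + _).
by rewrite mul_mx_scalar scale_scalar_mx.
Qed.

(** The ideal of [C] times a, the ideal of [D] times b and ab together generate
    a (b, C) + b (a, D), where (b, C) is resolved by the cone P of b on [C] and
    (a, D) by the cone Q of a on [D].  In degree 1, the last basis vectors of P
    and of Q are identified by [glue_left] and [glue_right], because a b and b a
    are the same generator. *)
Section Glue.
Variables (a b : A) (C D : rank1_complex).
Let P := cone b C.
Let Q := cone a D.

Definition glue_rank i :=
  if i is j.+1 then (prk P j.+1 + prk Q j.+1)%N else (prk C 0 + (prk D 0 + 1))%N.

Definition glue_left : 'M[A]_(prk C 0 + 1, prk C 0 + (prk D 0 + 1)) :=
  block_mx 1%:M 0 0 (row_mx 0 1%:M).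

Definition glue_right : 'M[A]_(prk D 0 + 1, prk C 0 + (prk D 0 + 1)) :=
  row_mx 0 1%:M.

Definition glue_diff i : 'M[A]_(glue_rank i, rank_from0 glue_rank i) :=
  match i return 'M[A]_(glue_rank i, rank_from0 glue_rank i) with
  | 0 => col_mx (a *: pdiff C 0) (col_mx (b *: pdiff D 0) (a * b)%:M)
  | 1 => col_mx (pdiff P 1 *m glue_left) (pdiff Q 1 *m glue_right)
  | j.+2 => block_mx (pdiff P j.+2) 0 0 (pdiff Q j.+2)
  end.

Definition glue := Rank1Complex glue_diff.

Hypotheses (Pacyc : acyclic P) (Qacyc : acyclic Q).
Hypotheses (a0 : a != 0) (b0 : b != 0).
Hypotheses (ab_coprime : forall x y, a * x = b * y -> exists t, x = b * t).

Lemma glue_diff1 :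
  pdiff glue 1 = col_mx (pdiff P 1 *m glue_left) (pdiff Q 1 *m glue_right).
Proof. by []. Qed.

Lemma glue_diffSS i :
  pdiff glue i.+2 = block_mx (pdiff P i.+2) 0 0 (pdiff Q i.+2).
Proof. by []. Qed.

Lemma mul_glue_left (u : 'rV_(prk C 0)) (w : 'rV_1) :
  row_mx u w *m glue_left = row_mx u (row_mx 0 w).
Proof.
by rewrite mul_row_block mulmx1 !mulmx0 addr0 add0r mul_mx_row mulmx0 mulmx1.
Qed.

Lemma mul_glue_right (u : 'rV_(prk D 0)) (w : 'rV_1) :
  row_mx u w *m glue_right = row_mx 0 (row_mx u w).
Proof. by rewrite mul_mx_row mulmx0 mulmx1. Qed.

(** Through the identification the first differential restricts to a times that
    of P; on the other side it restricts to b times that of Q. *)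
Lemma glue_leftE : glue_left *m pdiff glue 0 = a *: pdiff P 0.
Proof.
rewrite /= mul_block_col !mul0mx mul1mx addr0 add0r mul_row_col mul0mx mul1mx.
by rewrite add0r scale_col_mx scale_scalar_mx.
Qed.

Lemma glue_rightE : glue_right *m pdiff glue 0 = b *: pdiff Q 0.
Proof.
by rewrite /= mul_row_col mul0mx mul1mx add0r scale_col_mx scale_scalar_mx mulrC.
Qed.

Lemma coprime_sym x y : b * x = a * y -> exists t, x = a * t.
Proof.
move=> /esym abE; have [t tE] := ab_coprime abE; exists t.
by apply: (mulfI b0); rewrite -abE tE mulrCA.
Qed.

Lemma glue_mul0 i : pdiff glue i.+1 *m pdiff glue i = 0.
Proof.
case: i => [|[|i]].
- rewrite glue_diff1 mul_col_mx -!mulmxA glue_leftE glue_rightE.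
  by rewrite -!scalemxAr !acyclic_mul0 // !scaler0 col_mx0.
- rewrite glue_diff1 glue_diffSS mul_block_col !mul0mx addr0 add0r !mulmxA.
  by rewrite !acyclic_mul0 // !mul0mx col_mx0.
- rewrite !glue_diffSS mulmx_block !mul0mx !mulmx0 !addr0 !add0r.
  by rewrite !acyclic_mul0 // block_mx0.
Qed.

(** Degree 1: if a d u + b d t + ab w = 0, then d u = b g and d t = a h by
    coprimality, so w = - g - h, and (u, - g), (t, - h) are cycles of P and Q
    whose images under the gluing maps add up to (u, t, w).
    Degree 2: if the boundaries of p and q glue to 0, they are (0, u2) and
    (0, t2) with u2 + t2 = 0; being cycles of P and Q they satisfy b u2 = 0 and
    a t2 = 0, so both vanish separately.
    Above, the complex is the direct sum of P and Q. *)
Lemma acyclic_glue : acyclic glue.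
Proof.
move=> i v; split; last by case=> w ->; rewrite -mulmxA glue_mul0 mulmx0.
case: i v => [|[|i]] v v0; rewrite -(hsubmxK v) in v0 *.
- move: (lsubmx v) (rsubmx v) v0 => u v' {v}.
  rewrite -(hsubmxK v'); move: (lsubmx v') (rsubmx v') => t w {v'}.
  rewrite [pdiff glue 0]/= !mul_row_col -!scalemxAr mul_mx_scalar => eq0.
  pose x := (u *m pdiff C 0) 0 0; pose y := (t *m pdiff D 0) 0 0.
  have {eq0} eq0 : a * x + (b * y + a * b * w 0 0) = 0.
    rewrite {}/x {}/y; move: (u *m _) (t *m _) eq0 => ux ty.
    by move/matrixP/(_ 0 0); rewrite !mxE.
  have [g gE] : exists g, x = b * g.
    apply: (@ab_coprime _ (- (y + a * w 0 0))); apply/eqP.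
    by rewrite mulrN -addr_eq0 mulrDr mulrA [b * a]mulrC eq0 eqxx.
  have [h hE] : exists h, y = a * h.
    apply: (@coprime_sym _ (- (x + b * w 0 0))); apply/eqP.
    by rewrite mulrN -addr_eq0 mulrDr mulrA addrCA eq0 eqxx.
  have wE : w 0 0 = - g - h.
    apply: (mulfI a0); apply: (mulfI b0); apply/eqP; rewrite -subr_eq0 -eq0 gE hE.
    by apply/eqP; ring.
  have /Pacyc[p pE] : row_mx u (- g)%:M *m pdiff P 0 = 0.
    rewrite /= mul_row_col mul_mx_scalar scale_scalar_mx mulrN -gE raddfN /=.
    by rewrite -mx11_scalar subrr.
  have /Qacyc[q qE] : row_mx t (- h)%:M *m pdiff Q 0 = 0.
    rewrite /= mul_row_col mul_mx_scalar scale_scalar_mx mulrN -hE raddfN /=.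
    by rewrite -mx11_scalar subrr.
  exists (row_mx p q); rewrite glue_diff1 mul_row_col !mulmxA -pE -qE.
  rewrite mul_glue_left mul_glue_right !add_row_mx addr0 !add0r.
  by rewrite (mx11_scalar w) wE raddfD.
- move: (lsubmx v) (rsubmx v) v0 => p q {v}; rewrite glue_diff1 mul_row_col !mulmxA.
  have := acyclic_mul0 0 Qacyc => /(congr1 (mulmx q)).
  have := acyclic_mul0 0 Pacyc => /(congr1 (mulmx p)).
  have Pk := iffLR (Pacyc p); have Qk := iffLR (Qacyc q).
  rewrite !mulmx0 !mulmxA; move: Pk Qk; move: (p *m _) (q *m _) => u t.
  rewrite -(hsubmxK u) -(hsubmxK t); move: (lsubmx u) (rsubmx u) => u1 u2 {u}.
  move: (lsubmx t) (rsubmx t) => t1 t2 {t} Pk Qk.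
  rewrite mul_glue_left mul_glue_right !add_row_mx addr0 !add0r.
  rewrite [pdiff P 0]/= [pdiff Q 0]/= !mul_row_col !mul_mx_scalar => Pu Qt.
  rewrite -row_mx0 => /eq_row_mx[u10].
  rewrite -row_mx0 => /eq_row_mx[t10 _].
  have u20 : u2 = 0 by apply: (scale_mx_eq0 b0); rewrite -Pu u10 mul0mx add0r.
  have t20 : t2 = 0 by apply: (scale_mx_eq0 a0); rewrite -Qt t10 mul0mx add0r.
  have [p' ->] : exists p', p = p' *m pdiff P 2.
    by apply: Pk; rewrite u10 u20 row_mx0.
  have [q' ->] : exists q', q = q' *m pdiff Q 2.
    by apply: Qk; rewrite t10 t20 row_mx0.
  exists (row_mx p' q').
  by rewrite glue_diffSS mul_row_block !mulmx0 addr0 add0r.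
- move: (lsubmx v) (rsubmx v) v0 => p q {v}.
  rewrite glue_diffSS mul_row_block !mulmx0 addr0 add0r -row_mx0.
  case/eq_row_mx=> p0 q0.
  have [p' ->] := iffLR (Pacyc p) p0; have [q' ->] := iffLR (Qacyc q) q0.
  exists (row_mx p' q').
  by rewrite glue_diffSS mul_row_block !mulmx0 addr0 add0r.
Qed.

Lemma complex_ideal_glue x :
  complex_ideal glue x <->
  exists y y' t, [/\ complex_ideal C y, complex_ideal D y'
                   & x = a * y + b * y' + a * b * t].
Proof.
split=> [[v] | [y [y' [t [[u uE] [u' u'E] ->]]]]].
  rewrite -(hsubmxK v) -(hsubmxK (rsubmx v)).
  move: (lsubmx v) (lsubmx (rsubmx v)) (rsubmx (rsubmx v)) => u u' w.
  rewrite /= !mul_row_col -!scalemxAr mul_mx_scalar => xE.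
  exists ((u *m pdiff C 0) 0 0), ((u' *m pdiff D 0) 0 0), (w 0 0); split.
  - by exists u; rewrite -mx11_scalar.
  - by exists u'; rewrite -mx11_scalar.
  - move: (u *m _) (u' *m _) xE => ux uy /matrixP/(_ 0 0).
    by rewrite !mxE eqxx mulr1n addrA.
exists (row_mx u (row_mx u' t%:M)).
rewrite /= !mul_row_col -!scalemxAr mul_mx_scalar -uE -u'E !scale_scalar_mx.
by rewrite !raddfD /= addrA.
Qed.

End Glue.

End Complexes.

(** * Koszul complexes of variables and resolutions *)

Section Koszul.
Variables (K : fieldType) (n : nat).
Notation R := {mpoly K[n]}.
Implicit Types (C : rank1_complex R) (vs : seq 'I_n).

Definition koszul vs : rank1_complex R :=
  foldr (fun i => cone 'X_i) (trivial_complex R) vs.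

Lemma koszul_rank vs i : prk (koszul vs) i = 'C(size vs, i.+1).
Proof.
elim: vs i => [|v vs IH] i //=; rewrite /cone_rank IH binS; congr (_ + _)%N.
by case: i => [|i] /=; rewrite ?bin0 ?IH.
Qed.

Lemma complex_ideal_is_ideal C : is_ideal (complex_ideal C).
Proof.
split; first by exists 0; rewrite raddf0 mul0mx.
- by move=> p q [u uE] [v vE]; exists (u + v); rewrite raddfD /= uE vE mulmxDl.
- move=> c p [v vE]; exists (c *: v).
  by rewrite -scalemxAl -vE scale_scalar_mx.
Qed.

Definition variable_ideal vs := monomial_ideal (K := K) [seq U_(i)%MM | i <- vs].

Lemma variable_ideal_is_ideal vs : is_ideal (variable_ideal vs).
Proof. exact: gen_ideal_is_ideal. Qed.

Lemma mem_variable_ideal vs i : i \in vs -> variable_ideal vs 'X_i.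
Proof. by move=> iv; apply/mem_gen_ideal/map_f/map_f. Qed.

Lemma complex_ideal_koszul vs p : complex_ideal (koszul vs) p <-> variable_ideal vs p.
Proof.
elim: vs p => [|v vs IH] p.
  split=> [[u]|[c ->]]; last first.
    by rewrite big_ord0; case: (complex_ideal_is_ideal (koszul [::])).
  rewrite [u]thinmx0 mul0mx => /matrixP/(_ 0 0); rewrite !mxE eqxx mulr1n => ->.
  by case: (variable_ideal_is_ideal [::]).
have [_ VD VM] := variable_ideal_is_ideal (v :: vs).
split=> [/complex_ideal_cone[q [t [/IH vq ->]]]|].
  apply: VD; last by rewrite mulrC; apply/VM/mem_variable_ideal/mem_head.
  apply: gen_ideal_sub vq => x xvs; apply: mem_gen_ideal.
  by rewrite inE xvs orbT.
apply: gen_ideal_least; first exact: complex_ideal_is_ideal.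
move=> x; rewrite inE => /predU1P[->|xvs]; apply/complex_ideal_cone.
  exists 0, 1; split; last by rewrite add0r mulr1.
  by case: (complex_ideal_is_ideal (koszul vs)).
exists x, 0; split; last by rewrite mulr0 addr0.
by apply/IH/mem_gen_ideal.
Qed.

Lemma variable_ideal_regular vs i p :
  i \notin vs -> variable_ideal vs ('X_i * p) -> variable_ideal vs p.
Proof.
move=> iv; apply: monomial_ideal_var_regular => _ /mapP[j jv ->].
by rewrite mnm1E; case: eqP => // ji; rewrite -ji jv in iv.
Qed.

(** By [variable_ideal_regular], a variable is regular modulo an ideal generated
    by other variables. *)
Lemma acyclic_koszul vs : uniq vs -> acyclic (koszul vs).
Proof.
elim: vs => [_|v vs IH /= /andP[v_vs /IH acyc]]; first exact: acyclic_trivial.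
apply: acyclic_cone => // p /complex_ideal_koszul vp; apply/complex_ideal_koszul.
exact: variable_ideal_regular v_vs vp.
Qed.

(** All entries homogeneous of degree [d]: since every basis vector in a given
    degree of the complexes below has the same internal degree, this is all that
    homogeneity of the maps means, and for [d] > 0 it gives minimality. *)
Definition homog_mx d m p (M : 'M[R]_(m, p)) := forall i j, M i j \is d.-homog.

Lemma homog_col d m1 m2 p (M : 'M_(m1, p)) (N : 'M_(m2, p)) :
  homog_mx d M -> homog_mx d N -> homog_mx d (col_mx M N).
Proof. by move=> hM hN i j; rewrite mxE; case: split_ordP. Qed.

Lemma homog_row d m p1 p2 (M : 'M_(m, p1)) (N : 'M_(m, p2)) :
  homog_mx d M -> homog_mx d N -> homog_mx d (row_mx M N).
Proof. by move=> hM hN i j; rewrite mxE; case: split_ordP. Qed.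

Lemma homog_block d m1 m2 p1 p2 (M : 'M_(m1, p1)) (N : 'M_(m1, p2))
    (P : 'M_(m2, p1)) (Q : 'M_(m2, p2)) :
  homog_mx d M -> homog_mx d N -> homog_mx d P -> homog_mx d Q ->
  homog_mx d (block_mx M N P Q).
Proof. by move=> hM hN hP hQ; apply: homog_col; apply: homog_row. Qed.

Lemma homog_0 d m p : homog_mx d (0 : 'M_(m, p)).
Proof. by move=> i j; rewrite mxE dhomog0. Qed.

Lemma homog_scalar d m x : x \is d.-homog -> homog_mx d (x%:M : 'M_m).
Proof. by move=> hx j k; rewrite mxE; case: eqP; rewrite ?mulr0n ?dhomog0. Qed.

Lemma homog_scale d e m p x (M : 'M_(m, p)) :
  x \is d.-homog -> homog_mx e M -> homog_mx (d + e) (x *: M).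
Proof. by move=> hx hM i j; rewrite mxE; apply: dhomogM. Qed.

Lemma homog_opp d m p (M : 'M_(m, p)) : homog_mx d M -> homog_mx d (- M).
Proof. by move=> hM i j; rewrite mxE dhomogN. Qed.

Lemma homog_mul d e m p k (M : 'M_(m, p)) (N : 'M_(p, k)) :
  homog_mx d M -> homog_mx e N -> homog_mx (d + e) (M *m N).
Proof.
move=> hM hN i j; rewrite mxE; apply: rpred_sum => l _.
exact: dhomogM.
Qed.

Lemma homog_X i : ('X_i : R) \is 1.-homog.
Proof. by rewrite dhomogX; apply/eqP/mdeg1. Qed.

Lemma homog_cone v C i :
  (forall j, homog_mx 1 (pdiff C j)) -> homog_mx 1 (pdiff (cone 'X_v C) i).
Proof.
have hX m : homog_mx 1 (('X_v)%:M : 'M[R]_m) by apply/homog_scalar/homog_X.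
move=> hC; case: i => [|i] /=; first exact: homog_col.
apply: homog_block => //.
  exact: homog_0.
exact/homog_opp/hC.
Qed.

Lemma homog_koszul vs i : homog_mx 1 (pdiff (koszul vs) i).
Proof.
by elim: vs i => [|v vs IH] i; [apply: homog_0 | apply: homog_cone].
Qed.

Lemma homog_glue u v C D :
    (forall j, homog_mx 1 (pdiff C j)) -> (forall j, homog_mx 1 (pdiff D j)) ->
  homog_mx 2 (pdiff (glue 'X_u 'X_v C D) 0) /\
  forall i, homog_mx 1 (pdiff (glue 'X_u 'X_v C D) i.+1).
Proof.
move=> hC hD.
have hP i : homog_mx 1 (pdiff (cone 'X_v C) i) by apply/homog_cone.
have hQ i : homog_mx 1 (pdiff (cone 'X_u D) i) by apply/homog_cone.
have h1 m : homog_mx 0 (1%:M : 'M[R]_m) by apply/homog_scalar/dhomog1.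
split.
  apply: homog_col; first exact: (homog_scale (homog_X u)).
  apply: homog_col; first exact: (homog_scale (homog_X v)).
  exact/homog_scalar/(dhomogM (homog_X u) (homog_X v)).
case=> [|i]; last by apply: homog_block => //; apply: homog_0.
have h0 m p : homog_mx 0 (0 : 'M[R]_(m, p)) by apply: homog_0.
apply: homog_col; apply: (@homog_mul 1 0) => //.
  by apply: homog_block => //; apply: homog_row.
exact: homog_row.
Qed.

Section Resolution.
Variables (I : R -> Prop) (C : rank1_complex R) (d : nat).
Hypotheses (CI : forall p, I p <-> complex_ideal C p) (acyc : acyclic C).
Hypotheses (C0 : homog_mx d.+1 (pdiff C 0)).
Hypotheses (CS : forall i, homog_mx 1 (pdiff C i.+1)).

(** With a first differential of degree [d] + 1 and linear ones after it, the
    basis in homological degree j + 1 sits in internal degree d + 1 + j. *)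
Definition resolution_shift i : 'I_(rank_from0 (prk C) i) -> int :=
  fun=> if i is j.+1 then (d.+1 + j)%:Z else 0.

Lemma resolution_of_complex :
  exists F : min_free_resolution I, forall i, rk F i = rank_from0 (prk C) i.
Proof.
have pdiff_homog i j k m : m \in msupp (pdiff C i j k) ->
    mdeg m = if i is 0 then d.+1 else 1%N.
  by case: i j k => [|i] j k; apply: dhomog_mf; [apply: C0 | apply: CS].
unshelve eexists (@MinFreeResolution K n I (rank_from0 (prk C)) resolution_shift
  1%:M (pdiff C) _ _ _ _ _ _) => //.
- by move=> j m; rewrite [j]ord1 mxE eqxx msupp1 inE => /eqP->; rewrite mdeg0.
- move=> i j k m /pdiff_homog ->; case: i j k => [|i] j k /=.
    by rewrite addr0 addn0.
  by rewrite -PoszD addnC -addnA addn1.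
- move=> p; exists p%:M; rewrite mulmx1 mxE eqxx subrr.
  by apply/CI; case: (complex_ideal_is_ideal C).
- move=> v; rewrite mulmx1; split=> [/CI[w wE]|[w vE]].
    by exists w; rewrite -wE -mx11_scalar.
  by apply/CI; exists w; rewrite -vE -mx11_scalar.
- move=> i j k; apply: memN_msupp_eq0; apply/negP=> /pdiff_homog.
  by rewrite mdeg0; case: i j k.
Qed.

End Resolution.
End Koszul.

(** * The arithmetical rank and the maximal degree of a graph *)

Section MaximalDegree.
Variables (K : fieldType) (n : nat) (G : sgraph n).

Lemma adj_edge_ideal u v : G u v -> edge_ideal K G ('X_u * 'X_v).
Proof. by move=> uv; apply/mem_gen_ideal/imageP; exists (u, v). Qed.

Lemma const_coeff_is_ideal (m : nat) :
  is_ideal (fun p : {mpoly K[m]} => p@_0%MM = 0).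
Proof.
split; first exact: mcoeff0.
- by move=> p q p0 q0; rewrite mcoeffD p0 q0 addr0.
- by move=> c p p0; rewrite (rmorphM (mcoeff 0%MM)) /= p0 mulr0.
Qed.

(** Under the substitution sending [u] to 1, the neighbours of [u] to the
    variables of a new polynomial ring and every other vertex to 0, an edge at
    [u] becomes a variable and any other edge a polynomial without constant
    term.  Hence the images of [q] have the ideal of all variables as radical,
    and [radical_maximal_ideal_size] applies. *)
Lemma degree_le_ara u q :
  gen_up_to_radical (edge_ideal K G) q -> (degree G u <= size q)%N.
Proof.
move=> Iq; pose N := [set w | G u w].
(* The sum has one term for a neighbour of u, and none for another vertex. *)
pose value v : {mpoly K[#|N|]} :=
  (v == u)%:R + \sum_(i < #|N| | enum_val i == v) 'X_i.
pose phi := comp_mpoly [tuple value v | v < n].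
have phiX v : phi 'X_v = value v.
  by rewrite /phi comp_mpolyXU -tnth_nth tnth_mktuple.
have value0 v : v != u -> (value v)@_0%MM = 0.
  move=> /negPf vu; rewrite /value vu add0r raddf_sum big1 // => i _ /=.
  by rewrite mcoeffX mnm1_eq0.
have phi_edge p : edge_ideal K G p -> (phi p)@_0%MM = 0.
  have [_ _ cM] := const_coeff_is_ideal #|N|.
  move: p; apply: gen_ideal_least.
    exact: (ideal_preim (comp_mpoly [tuple value v | v < n]) (const_coeff_is_ideal _)).
  move=> _ /imageP[[v w] /= vw ->]; rewrite /phi rmorphM /= -!/(phi _) !phiX.
  have [vu|/value0 v0] := eqVneq v u; last by rewrite mulrC cM.
  have /value0 w0 : w != u; last by rewrite cM.
  by apply: contraTneq (vw : G v w) => ->; rewrite -vu adj_irrefl.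
rewrite -[degree G u]/#|N| -(size_map phi).
apply: radical_maximal_ideal_size => [i|_ /mapP[p pq ->]].
  have uw : G u (enum_val i) by have := enum_valP i; rewrite inE.
  have [k qk] : radical (gen_ideal q) ('X_u * 'X_(enum_val i)).
    by apply/Iq; apply: radical_sub; apply: adj_edge_ideal.
  exists k; suff -> : 'X_i = phi ('X_u * 'X_(enum_val i)).
    rewrite /phi -rmorphXn /=; move: (_ ^+ k) qk.
    apply: gen_ideal_least.
      exact: (ideal_preim (comp_mpoly [tuple value v | v < n]) (gen_ideal_is_ideal _)).
    by move=> p pq; apply/mem_gen_ideal/map_f.
  rewrite /phi rmorphM /= -!/(phi _) !phiX /value eqxx.
  rewrite (negPf (_ : enum_val i != u)); last first.
    by apply: contraTneq uw => ->; rewrite adj_irrefl.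
  rewrite (big1 _ (fun i => enum_val i == u)) => [|j /eqP ju]; last first.
    by have := enum_valP j; rewrite inE ju adj_irrefl.
  rewrite addr0 mul1r add0r (bigD1 i) //= big1 ?addr0 // => j.
  by case/andP=> /eqP/enum_val_inj->; rewrite eqxx.
have [k /phi_edge] : radical (edge_ideal K G) p.
  by apply/Iq; apply/radical_sub/mem_gen_ideal.
rewrite /phi rmorphXn /= (rmorphXn (mcoeff 0%MM)) /= => /eqP.
by rewrite expf_eq0 => /andP[_ /eqP].
Qed.

End MaximalDegree.

(** * The combinatorics of the double star *)

Section DoubleStarCombinatorics.
Variables r s : nat.
Notation n := (2 + (r + s))%N.
Notation a := (va r s).
Notation b := (vb r s).
Notation x := (@vx r s).
Notation y := (@vy r s).
Notation T := (double_star r s).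

Definition x_vars : seq 'I_n := [seq x i | i <- enum 'I_r].
Definition y_vars : seq 'I_n := [seq y j | j <- enum 'I_s].

Lemma va_vb : a != b. Proof. by rewrite -val_eqE. Qed.
Lemma va_vx i : a != x i. Proof. by rewrite -val_eqE. Qed.
Lemma va_vy j : a != y j. Proof. by rewrite -val_eqE. Qed.
Lemma vb_vx i : b != x i. Proof. by rewrite -val_eqE. Qed.
Lemma vb_vy j : b != y j. Proof. by rewrite -val_eqE. Qed.
Lemma vx_inj : injective x.
Proof. by move=> i j /rshift_inj/lshift_inj. Qed.
Lemma vy_inj : injective y.
Proof. by move=> i j /rshift_inj/rshift_inj. Qed.

Lemma vx_vy i j : x i != y j.
Proof. by rewrite (inj_eq (@rshift_inj _ _)) eq_lrshift. Qed.

Lemma uniq_vb_x : uniq (b :: x_vars).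
Proof.
rewrite /= map_inj_uniq ?enum_uniq ?andbT; last exact: vx_inj.
by apply/negP=> /mapP[i _ bx]; have := vb_vx i; rewrite bx eqxx.
Qed.

Lemma uniq_va_y : uniq (a :: y_vars).
Proof.
rewrite /= map_inj_uniq ?enum_uniq ?andbT; last exact: vy_inj.
by apply/negP=> /mapP[i _ ay]; have := va_vy i; rewrite ay eqxx.
Qed.

Definition ds_edges : seq 'X_{1..n} :=
  (U_(a) + U_(b))%MM ::
    [seq (U_(a) + U_(v))%MM | v <- x_vars] ++ [seq (U_(b) + U_(v))%MM | v <- y_vars].

Lemma size_ds_edges : size ds_edges = (r + s).+1.
Proof. by rewrite /= size_cat !(size_enum_ord, size_map). Qed.

Lemma ds_adj_ab : T a b.
Proof. by rewrite /= /ds_adj /ds_arc !eqxx. Qed.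

Lemma ds_adj_ax i : T a (x i).
Proof.
apply/orP; left; apply/or3P; apply: Or32; rewrite eqxx /=.
by apply/existsP; exists i.
Qed.

Lemma ds_adj_by j : T b (y j).
Proof.
apply/orP; left; apply/or3P; apply: Or33; rewrite eqxx /=.
by apply/existsP; exists j.
Qed.

Lemma mem_ds_edges e :
  reflect (exists2 p : 'I_n * 'I_n, T p.1 p.2 & e = (U_(p.1) + U_(p.2))%MM)
          (e \in ds_edges).
Proof.
apply: (iffP idP) => [|[[u v] /= uv ->]].
  rewrite inE mem_cat.
  case/or3P=> [/eqP->|/mapP[_ /mapP[i _ ->] ->]|/mapP[_ /mapP[j _ ->] ->]].
  - by exists (a, b) => //; apply: ds_adj_ab.
  - by exists (a, x i) => //; apply: ds_adj_ax.
  - by exists (b, y j) => //; apply: ds_adj_by.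
wlog {uv} : u v / ds_arc u v.
  by move=> arc; case/orP: uv => /arc //; rewrite addmC.
rewrite inE mem_cat; case/or3P=> /andP[/eqP->].
- by move/eqP->; rewrite eqxx.
- by case/existsP=> i /eqP->; apply/or3P/Or32/map_f/map_f; rewrite mem_enum.
- by case/existsP=> j /eqP->; apply/or3P/Or33/map_f/map_f; rewrite mem_enum.
Qed.

(** Two monomials of the same degree dividing one another are equal. *)
Lemma ds_edges_antichain : {in ds_edges &, forall e f, (e <= f)%MM -> e = f}.
Proof.
have deg2 e : e \in ds_edges -> mdeg e = 2%N.
  by case/mem_ds_edges=> p _ ->; rewrite mdegD !mdeg1.
move=> e f /deg2 e2 /deg2 f2 /submK ef; rewrite -ef in f2 *.
move: f2; rewrite mdegD e2 => /(canRL (addnK _))/eqP.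
by rewrite mdeg_eq0 => /eqP->; rewrite add0m.
Qed.

Lemma uniq_ds_edges : uniq ds_edges.
Proof.
have injU w : injective (fun v : 'I_n => (U_(w) + U_(v))%MM).
  by move=> u v /addmI /eqP; rewrite eq_mnm1 => /eqP.
have /andP[b_x ux] : (b \notin x_vars) && uniq x_vars := uniq_vb_x.
have /andP[a_y uy] : (a \notin y_vars) && uniq y_vars := uniq_va_y.
rewrite /= cat_uniq (map_inj_uniq (@injU a)) (map_inj_uniq (@injU b)) ux uy andbT /=.
rewrite mem_cat negb_or (mem_map (@injU a)) b_x addmC (mem_map (@injU b)) a_y /=.
apply/hasPn=> _ /mapP[v vy ->]; apply/negP=> /mapP[u ux' /mnmP/(_ a)].
rewrite !mnmDE !mnm1E eqxx [b == a]eq_sym (negPf va_vb) add1n.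
by case: eqP vy => // ->; rewrite (negPf a_y).
Qed.

Lemma degree_va : degree T a = r.+1.
Proof.
rewrite /degree (_ : [set w | _] = b |: [set x i | i in 'I_r]).
  rewrite cardsU1 card_imset ?card_ord; last exact: vx_inj.
  rewrite (_ : b \notin _) //; apply/imsetP=> -[i _ bx].
  by have := vb_vx i; rewrite bx eqxx.
apply/setP=> w; rewrite !inE; apply/idP/predU1P.
  case/orP=> /or3P[]; rewrite ?eqxx ?(negPf va_vb) //=.
  - by move/eqP; left.
  - by case/existsP=> i /eqP->; right; apply: imset_f.
  - by rewrite andbF.
  - case/andP=> _ /existsP[i /eqP ax]; by have := va_vx i; rewrite ax eqxx.
  - case/andP=> _ /existsP[i /eqP ay]; by have := va_vy i; rewrite ay eqxx.
case=> [->|/imsetP[i _ ->]]; [exact: ds_adj_ab | exact: ds_adj_ax].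
Qed.

Lemma degree_vb : degree T b = s.+1.
Proof.
rewrite /degree (_ : [set w | _] = a |: [set y i | i in 'I_s]).
  rewrite cardsU1 card_imset ?card_ord; last exact: vy_inj.
  rewrite (_ : a \notin _) //; apply/imsetP=> -[i _ ay].
  by have := va_vy i; rewrite ay eqxx.
have b_a : (b == a) = false by rewrite eq_sym (negPf va_vb).
apply/setP=> w; rewrite !inE; apply/idP/predU1P.
  case/orP=> /or3P[]; rewrite ?eqxx ?b_a //=.
  - by case/existsP=> i /eqP->; right; apply: imset_f.
  - by rewrite andbT => /eqP; left.
  - case/andP=> _ /existsP[i /eqP bx]; by have := vb_vx i; rewrite bx eqxx.
  - case/andP=> _ /existsP[i /eqP by_]; by have := vb_vy i; rewrite by_ eqxx.
case=> [->|/imsetP[i _ ->]]; last exact: ds_adj_by.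
by rewrite (adj_sym T) ds_adj_ab.
Qed.

Lemma degree_vx i : (degree T (x i) <= 1)%N.
Proof.
rewrite -[X in (_ <= X)%N](cards1 a); apply/subset_leq_card/subsetP=> w; rewrite !inE.
case/orP=> /or3P[] /andP[/eqP xa]; try by move=> /existsP[j /eqP xy];
  have := vx_vy i j; rewrite xy eqxx.
- by have := va_vx i; rewrite xa eqxx.
- by have := va_vx i; rewrite xa eqxx.
- by have := vb_vx i; rewrite xa eqxx.
- by rewrite xa.
- by rewrite xa.
Qed.

Lemma degree_vy j : (degree T (y j) <= 1)%N.
Proof.
rewrite -[X in (_ <= X)%N](cards1 b); apply/subset_leq_card/subsetP=> w; rewrite !inE.
case/orP=> /or3P[] /andP[/eqP ya]; try by move=> /existsP[i /eqP xy];
  have := vx_vy i j; rewrite xy eqxx.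
- by have := va_vy j; rewrite ya eqxx.
- by have := va_vy j; rewrite ya eqxx.
- by have := vb_vy j; rewrite ya eqxx.
- by move/eqP=> yb; have := vb_vy j; rewrite yb eqxx.
- by rewrite ya.
Qed.

(** The edge ab realises the maximum; every other edge has a leaf as an end. *)
Lemma rho_double_star : rho T = (minn r s).+1.
Proof.
apply/eqP; rewrite eqn_leq -minnSS -degree_va -degree_vb; apply/andP; split; last first.
  exact: (leq_bigmax_cond (F := fun p : 'I_n * 'I_n =>
    minn (degree T p.1) (degree T p.2)) (a, b) ds_adj_ab).
apply/bigmax_leqP=> -[u v] /= uv.
wlog {uv} : u v / ds_arc u v.
  by move=> arc; case/orP: uv => /arc //; rewrite [X in (X <= _)%N]minnC.
have min1 : (1 <= minn (degree T a) (degree T b))%N.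
  by rewrite degree_va degree_vb minnSS.
case/or3P=> /andP[/eqP->]; first by move/eqP->; rewrite leqnn.
- case/existsP=> i /eqP->; apply: leq_trans min1.
  exact: leq_trans (geq_minr _ _) (degree_vx i).
- case/existsP=> j /eqP->; apply: leq_trans min1.
  exact: leq_trans (geq_minr _ _) (degree_vy j).
Qed.

End DoubleStarCombinatorics.

(** * The edge ideal of the double star *)

Section DoubleStarIdeal.
Variables (K : fieldType) (r s : nat).
Notation n := (2 + (r + s))%N.
Notation R := {mpoly K[n]}.
Notation a := (va r s).
Notation b := (vb r s).
Notation x := (@vx r s).
Notation y := (@vy r s).
Notation I := (edge_ideal K (double_star r s)).

Lemma monomial_gens_ds_edges : monomial_gens I (ds_edges r s).
Proof.
move=> p; split; apply: gen_ideal_sub => q.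
  case/mapP=> e /mem_ds_edges[uv adj_uv ->] ->; rewrite mpolyXD.
  exact: (adj_edge_ideal K adj_uv).
case/imageP=> uv adj_uv ->; rewrite -mpolyXD; apply/mem_gen_ideal/map_f.
by apply/mem_ds_edges; exists uv.
Qed.

Lemma ds_ideal_least (J : R -> Prop) : is_ideal J ->
    J ('X_a * 'X_b) -> (forall i, J ('X_a * 'X_(x i))) ->
    (forall j, J ('X_b * 'X_(y j))) ->
  forall p, I p -> J p.
Proof.
move=> JI Jab Jax Jby p /monomial_gens_ds_edges; move: p.
apply: gen_ideal_least => // _ /mapP[e eE ->]; move: eE; rewrite inE mem_cat.
case/or3P=> [/eqP->|/mapP[_ /mapP[i _ ->] ->]|/mapP[_ /mapP[j _ ->] ->]];
  by rewrite mpolyXD.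
Qed.

Lemma mu_double_star : is_mu I (r + s).+1.
Proof.
rewrite -(size_ds_edges r s); apply: antichain_is_mu.
- exact: uniq_ds_edges.
- exact: ds_edges_antichain.
- exact: monomial_gens_ds_edges.
Qed.

Definition X_padded (k : nat) : R := if insub k is Some i then 'X_(x i) else 0.
Definition Y_padded (k : nat) : R := if insub k is Some j then 'X_(y j) else 0.

Definition ds_radical_gens : seq R :=
  'X_a * 'X_b ::
  [seq 'X_a * X_padded k + 'X_b * Y_padded k | k <- iota 0 (maxn r s)].

(** (a x_i)^2 = a x_i (a x_i + b y_i) - x_i y_i (ab), and symmetrically for
    b y_j. *)
Lemma ds_radical_gensP : gen_up_to_radical I ds_radical_gens.
Proof.
have [I0 ID IM] := edge_ideal_is_ideal K (double_star r s).
have gI := gen_ideal_is_ideal ds_radical_gens; have [_ _ gM] := gI.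
have gab : gen_ideal ds_radical_gens ('X_a * 'X_b).
  exact/mem_gen_ideal/mem_head.
have gsum k : (k < maxn r s)%N ->
    gen_ideal ds_radical_gens ('X_a * X_padded k + 'X_b * Y_padded k).
  move=> k_lt; apply: mem_gen_ideal; rewrite inE; apply/orP; right.
  by apply: (map_f (fun k => 'X_a * X_padded k + _)); rewrite mem_iota.
apply: gen_up_to_radicalP => //.
  move=> p; rewrite inE => /predU1P[->|/mapP[k _ ->]].
    exact/adj_edge_ideal/ds_adj_ab.
  apply: ID; rewrite /X_padded /Y_padded; case: insubP => [i _ _|_];
    rewrite ?mulr0 //; apply: adj_edge_ideal; [exact: ds_adj_ax | exact: ds_adj_by].
apply: ds_ideal_least => [||i|j]; first exact: radical_is_ideal.
- exact: radical_sub.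
- exists 2; have {gsum} := gsum i; rewrite {1}/X_padded valK => gsum.
  have -> : ('X_a * 'X_(x i)) ^+ 2 =
      'X_a * 'X_(x i) * ('X_a * 'X_(x i) + 'X_b * Y_padded i)
      + (- ('X_(x i) * Y_padded i)) * ('X_a * 'X_b) :> R by ring.
  have [_ gD _] := gI; apply: gD; apply: (gM) => //; apply: gsum.
  exact: leq_trans (ltn_ord i) (leq_maxl _ _).
- exists 2; have {gsum} := gsum j; rewrite {1}/Y_padded valK => gsum.
  have -> : ('X_b * 'X_(y j)) ^+ 2 =
      'X_b * 'X_(y j) * ('X_a * X_padded j + 'X_b * 'X_(y j))
      + (- (X_padded j * 'X_(y j))) * ('X_a * 'X_b) :> R by ring.
  have [_ gD _] := gI; apply: gD; apply: (gM) => //; apply: gsum.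
  exact: leq_trans (ltn_ord j) (leq_maxr _ _).
Qed.

(** The vertices a and b have degrees r + 1 and s + 1. *)
Lemma ara_double_star : is_ara I (maxn r s).+1.
Proof.
split.
  exists ds_radical_gens; last exact: ds_radical_gensP.
  by rewrite /= size_map size_iota.
move=> q Iq; rewrite -maxnSS geq_max -(degree_va r s) -(degree_vb r s).
by rewrite !degree_le_ara.
Qed.

Definition ds_complex : rank1_complex R :=
  glue 'X_a 'X_b (koszul K (x_vars r s)) (koszul K (y_vars r s)).

Lemma X_neq0 (i : 'I_n) : 'X_i != 0 :> R.
Proof. by rewrite -msupp_eq0 msuppX. Qed.

Lemma X_coprime (i j : 'I_n) (p q : R) :
  i != j -> 'X_i * p = 'X_j * q -> exists t, p = 'X_j * t.
Proof.
move=> ij pq; apply/monomial_ideal1P; apply: (@monomial_ideal_var_regular _ _ _ i).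
  by move=> e; rewrite inE => /eqP->; rewrite mnm1E eq_sym (negPf ij).
by apply/monomial_ideal1P; exists q.
Qed.

Lemma acyclic_ds_complex : acyclic ds_complex.
Proof.
apply: acyclic_glue.
- exact: (acyclic_koszul (vs := b :: x_vars r s)) (uniq_vb_x r s).
- exact: (acyclic_koszul (vs := a :: y_vars r s)) (uniq_va_y r s).
- exact: X_neq0.
- exact: X_neq0.
- by move=> p q; apply: X_coprime; apply: va_vb.
Qed.

Lemma ideal_mull (J : R -> Prop) c : is_ideal J -> is_ideal (fun p => J (c * p)).
Proof.
case=> J0 JD JM; split; first by rewrite mulr0.
- by move=> p q Jp Jq; rewrite mulrDr; apply: JD.
- by move=> d p Jp; rewrite mulrCA; apply: JM.
Qed.

Lemma complex_ideal_ds_complex p : I p <-> complex_ideal ds_complex p.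
Proof.
have II := edge_ideal_is_ideal K (double_star r s); have [I0 ID IM] := II.
split.
  move: p; apply: ds_ideal_least; first exact: complex_ideal_is_ideal.
  - apply/complex_ideal_glue; exists 0, 0, 1; split; last by ring.
      by case: (complex_ideal_is_ideal (koszul K (x_vars r s))).
    by case: (complex_ideal_is_ideal (koszul K (y_vars r s))).
  - move=> i; apply/complex_ideal_glue; exists 'X_(x i), 0, 0; split; last by ring.
      by apply/complex_ideal_koszul/mem_variable_ideal/map_f; rewrite mem_enum.
    by case: (complex_ideal_is_ideal (koszul K (y_vars r s))).
  - move=> j; apply/complex_ideal_glue; exists 0, 'X_(y j), 0; split; last by ring.
      by case: (complex_ideal_is_ideal (koszul K (x_vars r s))).
    by apply/complex_ideal_koszul/mem_variable_ideal/map_f; rewrite mem_enum.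
case/complex_ideal_glue=> f [g [t [fC gD ->]]].
move/complex_ideal_koszul: fC => xf; move/complex_ideal_koszul: gD => yg.
apply: (ID); last by rewrite mulrC; apply/IM/adj_edge_ideal/ds_adj_ab.
apply: ID.
  move: f xf; apply: gen_ideal_least; first exact: ideal_mull.
  move=> _ /mapP[_ /mapP[_ /mapP[i _ ->] ->] ->].
  exact/adj_edge_ideal/ds_adj_ax.
move: g yg; apply: gen_ideal_least; first exact: ideal_mull.
move=> _ /mapP[_ /mapP[_ /mapP[j _ ->] ->] ->].
exact/adj_edge_ideal/ds_adj_by.
Qed.

Lemma ds_complex_rankS i :
  prk ds_complex i.+1 = ('C(r.+1, i.+2) + 'C(s.+1, i.+2))%N.
Proof.
by rewrite /= /cone_rank /= !koszul_rank !(size_enum_ord, size_map) !binS.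
Qed.

(** In degree max(r, s) + 1 the binomial coefficient of the longer Koszul complex
    is 1, and above it both vanish.  For r = s = 0 the top degree is 1, and its
    basis vector is the one over ab. *)
Lemma pd_double_star : is_pd I (maxn r s).+1.
Proof.
have [h0 hS] := homog_glue a b (@homog_koszul K n (x_vars r s))
  (@homog_koszul K n (y_vars r s)).
have [F rkF] := resolution_of_complex complex_ideal_ds_complex acyclic_ds_complex h0 hS.
apply: (pd_of_resolution (edge_ideal_is_ideal K _) (F := F)); split.
  rewrite rkF; case max_rs: (maxn r s) => [|k]; first by rewrite /= addnA addn1.
  rewrite -[rank_from0 _ _]/(prk ds_complex k.+1) ds_complex_rankS addn_gt0.
  rewrite !bin_gt0 !ltnS; apply/orP.
  by move: max_rs; case: (leqP r s) => rs; [right | left]; rewrite max_rs.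
case=> [//|[//|i]]; rewrite !ltnS geq_max rkF => /andP[le_ri le_si].
by rewrite [LHS]ds_complex_rankS !bin_small.
Qed.

End DoubleStarIdeal.

Theorem mainTheorem3 (K : fieldType) (r s : nat) :
  exists ara pd mu : nat,
    [/\ is_ara (edge_ideal K (double_star r s)) ara,
        is_pd (edge_ideal K (double_star r s)) pd
      & is_mu (edge_ideal K (double_star r s)) mu] /\
    [/\ ara = pd,
        (pd%:Z = mu%:Z - (rho (double_star r s))%:Z + 1)%R
      & (mu%:Z - (rho (double_star r s))%:Z + 1 = (maxn r s)%:Z + 1)%R].
Proof.
have mu_rho : ((r + s).+1%:Z - (rho (double_star r s))%:Z + 1 = (maxn r s)%:Z + 1)%R.
  rewrite rho_double_star -addn_min_max !intS PoszD; ring.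
exists (maxn r s).+1, (maxn r s).+1, (r + s).+1; split; split=> //.
- exact: ara_double_star.
- exact: pd_double_star.
- exact: mu_double_star.
- by rewrite mu_rho intS addrC.
Qed.
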